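(* Let $R$ be a unital associative ring, $M$ a nonzero left $R$-module, and $\Omega$ an infinite set. Let $N$ denote either $\bigoplus_{\alpha\in\Omega} M_\alpha$ or $\prod_{\alpha\in\Omega} M_\alpha$, where $M_\alpha = M$ for each $\alpha\in\Omega$, and let $E = \mathrm{End}_R(N)$. Then every countable subset of $E$ is contained in a $2$-generator subsemigroup of $E$, where $E$ is viewed as a multiplicative semigroup.
   Context: The multiplication of $E$ is composition of endomorphisms; endomorphisms are written on the right of their arguments, so $x(fg) = (xf)g$. A $2$-generator subsemigroup is a subsemigroup generated by two elements. The result is asserted under both interpretations of $N$ (direct sum and direct product). *)

(* Defs.v *)
From HB Require Import structures.
From mathcomp Require Import all_boot all_order all_algebra.
From mathcomp Require Import all_classical.

Set Implicit Arguments.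
Unset Strict Implicit.
Unset Printing Implicit Defensive.

Import GRing.Theory.
Local Open Scope classical_set_scope.
Local Open Scope ring_scope.

Definition endo (R : pzRingType) (N : lmodType R) : Type := {linear N -> N}.

Section EndoSemigroup.
Variables (R : pzRingType) (N : lmodType R).

(* Endomorphisms act on the right of their arguments: x (f g) = (x f) g. *)
Definition endo_mul (f g : endo N) : endo N :=
  (g : {linear N -> N}) \o (f : {linear N -> N}).

Lemma endo_mulE (f g : endo N) (x : N) : endo_mul f g x = g (f x).
Proof. by []. Qed.

Lemma endoP (f g : endo N) : (forall x, f x = g x) -> f = g.
Proof.
case: f g => [f [[f0] [fZ]]] [g [[g0] [gZ]]] /= fg.
have e : f = g by apply/funext => x; exact: fg.
by subst g; rewrite (Prop_irrelevance f0 g0) (Prop_irrelevance fZ gZ).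
Qed.

Lemma endo_mulA : associative endo_mul.
Proof. by move=> f g h; apply: endoP. Qed.

HB.instance Definition _ := gen_eqMixin (endo N).
HB.instance Definition _ := gen_choiceMixin (endo N).
HB.instance Definition _ := isSemigroup.Build (endo N) endo_mulA.

End EndoSemigroup.

Section DirectSum.
Variables (R : pzRingType) (Omega : Type) (M : lmodType R).

Definition fin_support : {pred Omega -> M} :=
  fun u => `[< finite_set [set a | u a != 0] >].

Lemma fin_support_submod_closed : submod_closed fin_support.
Proof.
split=> [|c u v /asboolP fu /asboolP fv]; apply/asboolP.
  apply: (sub_finite_set _ (finite_set0 Omega)) => a /=.
  by rewrite eqxx.
apply: (@sub_finite_set _ _ ([set a | u a != 0] `|` [set a | v a != 0])).
  move=> a /=; have [ua0|] := eqVneq (u a) 0; last by left.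
  have [va0|] := eqVneq (v a) 0; last by right.
  have -> : (c *: u + v) a = c *: u a + v a by [].
  by rewrite ua0 va0 scaler0 addr0 eqxx.
by rewrite finite_setU.
Qed.

HB.instance Definition _ :=
  GRing.isSubmodClosed.Build R (Omega -> M) fin_support fin_support_submod_closed.

Record dsum := DSum { dsum_val :> Omega -> M; _ : dsum_val \in fin_support }.

HB.instance Definition _ := [isSub for dsum_val].
HB.instance Definition _ := [Choice of dsum by <:].
HB.instance Definition _ := [SubChoice_isSubLmodule of dsum by <:].

End DirectSum.

Section Semigroups.
Variable G : semigroupType.

Definition subsemigroup (S : set G) : Prop := mulg_closed [in S].

Definition subsemigroup_gen (A : set G) : set G := smallest subsemigroup A.

Definition two_generator (S : set G) : Prop :=
  exists f g : G, S = subsemigroup_gen [set f; g].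

End Semigroups.

(* Main.v *)
Require Import Defs.
From HB Require Import structures.
From mathcomp Require Import all_boot all_order all_algebra.
From mathcomp Require Import all_classical.

(** Write [N] for the direct sum or the direct product. An infinite [Omega] is
in bijection with [Omega * nat], so [N] is isomorphic to the direct sum, or
product, of countably many copies of itself, and this is all that the proof
uses. Endomorphisms act on the right, so [f * g] is [f] followed by [g].

Product. Let [p n] be the projection on the [n]-th copy. An endomorphism [t] is
determined by its components [t * p n], and these can be prescribed freely.
Given endomorphisms [f n], choose [t] with [t * p n = f n], and let [a] be the
shift, [a * p n = p n.+1]. Then [p n = a ^ n * p 0], so that every
[f n = t * a ^ n * p 0] is a word in [t], [a] and [p 0]. Two generators suffice
because [t] and [p 0] can be packed into a single [b]: let its component at
[0] be [t], and its component at [n.+1] be [p 0 * p n]. Then [b * a = p 0] and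
[b * p 0 = t], so [f n = b * (b * a) * a ^ n * (b * a)].

Direct sum. Reverse all products: with the inclusions [i n] of the copies
instead of the projections, an endomorphism is determined by the [i n * t],
which can be prescribed freely, and [f n = (a * b) * a ^ n * (a * b) * b].

Both arguments take place in an abstract semigroup, in
[countable_two_generator_product] and [countable_two_generator_coproduct]. The
bijection is [infinite_bij_prod_nat]. What remains is to check that [p n] and
[i n] have the stated universal properties; only the one for the direct sum
takes work, as it needs finite sums of endomorphisms. *)

Set Implicit Arguments.
Unset Strict Implicit.
Unset Printing Implicit Defensive.

Import GRing.Theory.
Local Open Scope classical_set_scope.

(** * An infinite set absorbs a countable factor *)

Lemma infinite_set_seq (T : Type) (A : set T) : infinite_set A ->
  exists2 h : nat -> T, injective h & range h `<=` A.
Proof.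
move=> /infiniteP /card_leP[f].
exists (fun n => val (f (SigSub (mem_set (I : [set: nat] n))))).
  move=> m n /val_inj /inj; rewrite !inE => /(_ I I) /(congr1 val); exact.
by move=> _ [n _ <-]; apply: set_mem; exact: valP.
Qed.

(** A maximal family [E] of injective sequences with pairwise disjoint ranges
misses only finitely many points, since otherwise these contain one more
sequence. Attach the missed points to one member [h0] of [E]. Each point then
has a sequence [h] and, among the points with this [h], a label in
[nat + nat]; together they determine it. The map sends [(x, n)] to the term of
[h] whose index encodes the label of [x] and [n]. *)
Lemma infinite_inj_prod_nat (T : Type) : infinite_set [set: T] ->
  exists f : T * nat -> T, injective f.
Proof.
move=> Tinf.
have [E [Einj Edisj Emax]] :=
  ex_maximal_disjoint_subcollection (fun h : nat -> T => range h)
                                    [set h | injective h].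
pose covered := \bigcup_(h in E) range h.
have rest_fin : finite_set (~` covered).
  apply: contrapT => /infinite_set_seq[g ginj gE].
  have Eg : ~ E g by move=> Eg; apply: (gE (g 0)) => //; exists g.
  apply: (Emax (g |` E)).
  - by split=> [h|/(_ g)]; [right|apply: contra_not Eg; apply; left].
  - by move=> h [->|/Einj].
  - move=> h k [->|Eh] [->|Ek] // [x [xh xk]].
    + by exfalso; apply: (gE x) => //; exists k.
    + by exfalso; apply: (gE x) => //; exists h.
    + by apply: Edisj => //; exists x.
have [h0 Eh0] : E !=set0.
  have := infinite_setN0 (infinite_setD Tinf rest_fin).
  by case=> x [_ /contrapT[h Eh _]]; exists h.
have [l linj] := countable_injP _ (finite_set_countable rest_fin).
have label x : { hc : (nat -> T) * (nat + nat) | E hc.1 /\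
    (if hc.2 is inl k then x = hc.1 k
     else (~` covered) x /\ hc.2 = inr (l x)) }.
  apply: cid; have [[h Eh [k _ <-]]|xN] := pselect (covered x).
    by exists (h, inl k).
  by exists (h0, inr (l x)).
exists (fun xn => (sval (label xn.1)).1 (pickle ((sval (label xn.1)).2, xn.2))).
move=> [x m] [y n] /=.
case: (label x) (label y) => [[h c] /= [Eh cx]] [[k d] /= [Ek dy]] hk.
(* The two images coincide and lie on [h] and on [k], whose ranges would
   otherwise be disjoint. *)
have ehk : h = k.
  apply: Edisj => //; exists (h (pickle (c, m))).
  by split; [|rewrite hk]; eexists.
rewrite -{}ehk in hk dy.
have /(pcan_inj pickleK)[ecd ->] := Einj _ Eh _ _ hk.
rewrite -{}ecd in dy; congr pair.
case: c {hk} cx dy => [i -> ->//|i [xN [->]] [yN [/linj]]].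
by rewrite !inE; exact.
Qed.

Lemma infinite_bij_prod_nat (T : Type) : infinite_set [set: T] ->
  exists f : T * nat -> T, bijective f.
Proof.
elim/Ppointed: T => T Tinf.
  by case: (infinite_setN0 Tinf) => x; case: (no x).
have [f finj] := infinite_inj_prod_nat Tinf.
have : ([set: T * nat] #= [set: T])%card.
  apply: Cantor_Bernstein.
    have /card_le_eql <- : (range f #= [set: T * nat])%card.
      by apply: inj_card_eq => x y _ _; exact: finj.
    exact: card_leT.
  have /card_le_eql <- : (range (fun x : T => (x, 0)) #= [set: T])%card.
    by apply: inj_card_eq => x y _ _ [].
  exact: card_leT.
by move=> /card_set_bijP[g]; rewrite setTT_bijective; exists g.
Qed.

(** * Packing a sequence into two generators *)

Section TwoGenerators.
Variable G : semigroupType.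
Implicit Types (A S : set G) (a b x : G).

Lemma subsemigroup_mul S x y : subsemigroup S -> S x -> S y -> S (x * y)%g.
Proof. by move=> SM Sx Sy; apply: set_mem; apply: SM; exact: mem_set. Qed.

Lemma subsemigroup_iter_mul S x a n :
  subsemigroup S -> S x -> S a -> S (iter n ( *%g^~ a) x).
Proof. by move=> SM Sx Sa; elim: n => //= n IHn; exact: subsemigroup_mul. Qed.

(** Membership in the generated subsemigroup is an intersection over all
subsemigroups, so it may be tested in an arbitrary one containing [a] and [b]. *)
Lemma two_generator_cover A a b :
  (forall S, subsemigroup S -> S a -> S b -> A `<=` S) ->
  exists2 S, two_generator S & A `<=` S.
Proof.
move=> AS; exists (subsemigroup_gen [set a; b]); first by exists a, b.
by move=> x Ax S [SM abS]; apply: AS Ax => //; apply: abS; [left|right].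
Qed.

Lemma countable_sub_range A x :
  countable A -> exists f : nat -> G, A `<=` range f.
Proof.
move=> /pfcard_geP[->|[f]]; first by exists (fun=> x).
by exists f => y /'surj_f.
Qed.

(** The hypotheses say that the [p n] exhibit the underlying object as the
product of countably many copies of itself. *)
Lemma countable_two_generator_product (p : nat -> G) :
    (forall x y, (forall n, x * p n = y * p n)%g -> x = y) ->
    (forall f : nat -> G, exists t, forall n, (t * p n = f n)%g) ->
  forall A, countable A -> exists2 S, two_generator S & A `<=` S.
Proof.
move=> p_sep p_univ A /(countable_sub_range (p 0))[f Af].
have [t tp] := p_univ f.
have [a ap] := p_univ (fun n => p n.+1).
(* The component of [b] at 0 carries the whole sequence, and the others make
   [b * a] equal to [p 0]. *)
have [b bp] := p_univ (fun n => if n is m.+1 then p 0 * p m else t)%g.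
have ba : (b * a = p 0)%g by apply: p_sep => n; rewrite -mulgA ap bp.
have pE x n : (x * p n = iter n ( *%g^~ a) x * p 0)%g.
  by elim: n x => //= n IHn x; rewrite -ap mulgA IHn -iterSr.
apply: (@two_generator_cover _ a b) => S SM Sa Sb _ /Af[n _ <-].
have Sp : S (p 0) by rewrite -ba; exact: subsemigroup_mul.
rewrite -tp pE -(bp 0); apply: subsemigroup_mul => //.
by apply: subsemigroup_iter_mul => //; exact: subsemigroup_mul.
Qed.

(** The mirror image of [countable_two_generator_product], with the order of
all products reversed. *)
Lemma countable_two_generator_coproduct (i : nat -> G) :
    (forall x y, (forall n, i n * x = i n * y)%g -> x = y) ->
    (forall f : nat -> G, exists t, forall n, (i n * t = f n)%g) ->
  forall A, countable A -> exists2 S, two_generator S & A `<=` S.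
Proof.
move=> i_sep i_univ A /(countable_sub_range (i 0))[f Af].
have [t it] := i_univ f.
have [a ia] := i_univ (fun n => i n.+1).
have [b ib] := i_univ (fun n => if n is m.+1 then i m * i 0 else t)%g.
have ab : (a * b = i 0)%g by apply: i_sep => n; rewrite mulgA ia ib.
have iE n : i n = iter n ( *%g^~ a) (i 0).
  by elim: n => //= n <-; rewrite ia.
apply: (@two_generator_cover _ a b) => S SM Sa Sb _ /Af[n _ <-].
have Si : S (i 0) by rewrite -ab; exact: subsemigroup_mul.
rewrite -it iE; apply: subsemigroup_mul => //.
  exact: subsemigroup_iter_mul.
by rewrite -(ib 0); exact: subsemigroup_mul.
Qed.

End TwoGenerators.

Local Open Scope ring_scope.

(** * Endomorphisms of the product and of the direct sum *)

Lemma endo_of_linear (R : pzRingType) (N : lmodType R) (h : N -> N) :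
  linear h -> exists e : endo N, forall x, e x = h x.
Proof.
move=> hlin.
pose hL := GRing.isLinear.Build R N N *:%R h hlin.
by exists (HB.pack_for {linear N -> N} h hL).
Qed.

Section Product.
Variables (R : pzRingType) (M : lmodType R) (Omega : Type).
Hypothesis Omega_infinite : infinite_set [set: Omega].

(** The [n]-th projection is restriction to the [n]-th copy of [Omega] under the
bijection; a function is the same as the family of its restrictions. *)
Lemma countable_two_generator_endo_prod (A : set (endo (Omega -> M))) :
  countable A -> exists2 S, two_generator S & A `<=` S.
Proof.
have [q [r qr rq]] := infinite_bij_prod_nat Omega_infinite.
have /choice[p pE] n : exists e : endo (Omega -> M),
    forall u, e u = fun w => u (q (w, n)).
  by apply: endo_of_linear.
apply: (@countable_two_generator_product _ p) => [x y xy|f].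
  apply: endoP => u; apply/funext => w; rewrite -[w]rq; case: (r w) => v n.
  have /(congr1 (fun e : endo _ => e u v)) := xy n.
  by rewrite !endo_mulE !pE.
have [t tE] : exists e : endo (Omega -> M),
    forall u, e u = fun w => f (r w).2 u (r w).1.
  by apply: endo_of_linear => c u v; apply/funext => w; rewrite linearP.
exists t => n; apply: endoP => u; apply/funext => w.
by rewrite endo_mulE pE tE qr.
Qed.

End Product.

Section Sum.
Variables (R : pzRingType) (M : lmodType R) (Omega : Type).
Hypothesis Omega_infinite : infinite_set [set: Omega].
Local Notation N := (dsum Omega M).

(** Describing an endomorphism of the direct sum by a map on all functions keeps
the support condition apart from the formula. *)
Lemma endo_of_fun_linear (h : (Omega -> M) -> Omega -> M) :
    (forall c u v w, h (c *: u + v) w = c *: h u w + h v w) ->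
    (forall u, finite_set [set w | u w != 0] ->
               finite_set [set w | h u w != 0]) ->
  exists e : endo N, forall (u : N) w, e u w = h u w.
Proof.
move=> hlin hfin.
have hsupp (u : N) : h u \in @fin_support R Omega M.
  by apply/asboolP/hfin/asboolP; exact: (valP u).
have [|e eE] := @endo_of_linear R N (fun u => DSum (hsupp u)).
  by move=> c u v; apply: val_inj; apply/funext => w; rewrite /= hlin.
by exists e => u w; rewrite eE.
Qed.

Lemma dsumP (u v : N) : (forall w, u w = v w) -> u = v.
Proof. by move=> uv; apply: val_inj; apply/funext. Qed.

Lemma dsum_sumE (I : Type) (s : seq I) (F : I -> N) w :
  (\sum_(k <- s) F k) w = \sum_(k <- s) F k w.
Proof.
elim: s => [|k s IHs]; first by rewrite !big_nil.
by rewrite !big_cons -IHs.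
Qed.

(** The inclusions [i n] extend by zero from the [n]-th copy of [Omega], and the
restrictions [p n] are needed to write [u] as the sum of the [i n (p n u)]. This
sum is finite since the support of [u] meets finitely many copies. The
endomorphism with prescribed [i n * t = f n] is therefore
[u |-> \sum_n f n (p n u)]. *)
Lemma countable_two_generator_endo_dsum (A : set (endo N)) :
  countable A -> exists2 S, two_generator S & A `<=` S.
Proof.
have [q [r qr rq]] := infinite_bij_prod_nat Omega_infinite.
have qinj := can_inj qr.
have /choice[p pE] n : exists e : endo N,
    forall (u : N) w, e u w = u (q (w, n)).
  apply: (@endo_of_fun_linear (fun u w => u (q (w, n)))) => // u ufin.
  apply: (@finite_preimage _ _ _ (fun w => q (w, n)) _ ufin).
  by move=> x y _ _ /qinj[].
have /choice[i iE] n : exists e : endo N,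
    forall (u : N) w, e u w = if (r w).2 == n then u (r w).1 else 0.
  apply: (@endo_of_fun_linear
    (fun u w => if (r w).2 == n then u (r w).1 else 0)).
    by move=> c u v w; case: ifP => //; rewrite scaler0 addr0.
  move=> u ufin.
  apply: sub_finite_set (finite_image (fun w => q (w, n)) ufin) => w /=.
  case: ifP => [/eqP rwn uw|]; last by rewrite eqxx.
  by exists (r w).1 => //; rewrite -rwn -surjective_pairing rq.
have piE m n u : p m (i n u) = if m == n then u else 0.
  by apply: dsumP => w; rewrite pE iE qr /=; case: ifP.
have p_fin u : exists k, forall n, (k <= n)%N -> p n u = 0.
  have ufin : finite_set [set w | u w != 0] by apply/asboolP; exact: (valP u).
  have /finite_seqP[X XE] := finite_image (fun w => (r w).2) ufin.
  exists (\max_(m <- X) m).+1 => n kn; apply: dsumP => w.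
  apply: contraPeq kn => upn; apply/negP; rewrite -ltnNge ltnS.
  apply: leq_bigmax_seq => //.
  suff : [set` X] n by [].
  by rewrite -XE; exists (q (w, n)); rewrite ?qr //= -pE.
have p_sum u k : (forall n, (k <= n)%N -> p n u = 0) ->
    u = \sum_(n < k) i n (p n u).
  move=> pk; apply: dsumP => w; rewrite dsum_sumE.
  have [rwk|krw] := ltnP (r w).2 k.
    rewrite (bigD1 (Ordinal rwk)) //= iE eqxx pE -surjective_pairing rq.
    rewrite big1 ?addr0 // => n nrw; rewrite iE ifN //.
    by rewrite eq_sym.
  rewrite big1 => [|n _].
    by rewrite -[w in LHS]rq [r w]surjective_pairing -pE pk.
  by rewrite iE ifN // gtn_eqF // (leq_trans _ krw).
apply: (@countable_two_generator_coproduct _ i) => [x y xy|f].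
  apply: endoP => u; have [k pk] := p_fin u.
  rewrite (p_sum u k pk) !raddf_sum; apply: eq_bigr => n _.
  exact: (congr1 (fun e : endo N => e (p n u)) (xy n)).
(* As a sum over all of [nat], [c u] involves no choice of a bound; additivity
   then compares bounded sums at a bound common to [u] and [v]. *)
pose c u := \sum_(n \in [set: nat]) f n (p n u).
have cE u k : (forall n, (k <= n)%N -> p n u = 0) ->
    c u = \sum_(n < k) f n (p n u).
  move=> pk; rewrite (fsbig_ord _ _ (fun n => f n (p n u))).
  apply/esym/fsbig_widen => // n [_ /= nk].
  by rewrite pk ?raddf0 // leqNgt; apply/negP.
have [t tE] : exists e : endo N, forall u, e u = c u.
  apply: endo_of_linear => a u v.
  have [k uk] := p_fin u; have [l vl] := p_fin v.
  have um n : (maxn k l <= n)%N -> p n u = 0.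
    by rewrite geq_max => /andP[kn _]; exact: uk.
  have vm n : (maxn k l <= n)%N -> p n v = 0.
    by rewrite geq_max => /andP[_ ln]; exact: vl.
  rewrite !(cE _ (maxn k l)) // => [|n mn].
    rewrite scaler_sumr -big_split; apply: eq_bigr => n _ /=.
    by rewrite !linearP.
  by rewrite linearP um // vm // scaler0 addr0.
exists t => n; apply: endoP => u.
rewrite endo_mulE tE (cE _ n.+1) => [|m nm].
  rewrite big_ord_recr /= piE eqxx big1 ?add0r // => m _.
  by rewrite piE ltn_eqF // raddf0.
by rewrite piE gtn_eqF.
Qed.

End Sum.

Theorem theorem1 (R : pzRingType) (M : lmodType R) (Omega : Type)
    (M_neq0 : exists x : M, x != 0)
    (Omega_infinite : infinite_set [set: Omega]) :
  (forall A : set (endo (dsum Omega M)), countable A ->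
     exists2 S : set (endo (dsum Omega M)), two_generator S & A `<=` S) /\
  (forall A : set (endo (Omega -> M)), countable A ->
     exists2 S : set (endo (Omega -> M)), two_generator S & A `<=` S).
Proof.
by split=> A; [exact: countable_two_generator_endo_dsum
              |exact: countable_two_generator_endo_prod].
Qed.
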